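(* Assume that there exists $q>0$ such that the following hold: (A4) there exist positive constants $a_0^1,a_0^2$ such that, for $l\in\{1,2\}$ and any $(s_k)\in\mathfrak S$, $\{h_nM_{l,q_n+1}\}_{n\ge1}$ is tight and $\max_{1\le k\le q_n}|h_nM_{l,k}-a_0^l(s_k-s_{k-1})|\to0$ in probability; and for any $p\in\mathbb N$ there exists a nonnegative constant $a_p^1$ such that $\max_{1\le k\le q_n}|h_n\mathrm{tr}(\mathcal E^1_{(k)}(GG^\top)^p)-a_p^1(s_k-s_{k-1})|\to0$ in probability for any $(s_k)\in\mathfrak S$; (B2-$q$) $\displaystyle\limsup_{u\to\infty}\sup_{n\ge1}\max_{l\in\{1,2\}}\sup_{0\le t\le nh_n-uh_n}u^qP(\mathcal N^{n,l}_{t+uh_n}-\mathcal N^{n,l}_t=0)<\infty$. Assume further that the family $\{\mathcal N^{n,l}_{t+h_n}-\mathcal N^{n,l}_t\}_{0\le t\le T_n-h_n,\ l\in\{1,2\},\ n\in\mathbb N}$ is tight and that $\sum_{k=1}^\infty k\alpha_k^n<\infty$ for every $n$. Then $a_1^1>0$.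
   Context: $(h_n)_{n\ge1}$ are positive numbers with $h_n\to0$, $T_n:=nh_n\to\infty$, $nh_n^2\to0$. For each $n$ and $l\in\{1,2\}$, $0=S^{n,l}_0<S^{n,l}_1<\dots<S^{n,l}_{M_l}=T_n$ are random times ($M_l$ a random positive integer depending on $n$). $I_i^l=(S^{n,l}_{i-1},S_i^{n,l}]$, $|\cdot|$ is interval length. $G$ is the $M_1\times M_2$ matrix $[G]_{ij}=|I_i^1\cap I_j^2|/(|I_i^1|^{1/2}|I_j^2|^{1/2})$. $\mathfrak S$ is the set of partitions $0=s_0<s_1<\cdots$ of $[0,\infty)$ with $\sup_{k\ge1}|s_k-s_{k-1}|\le1$ and $\inf_{k\ge1}|s_k-s_{k-1}|>0$. For $(s_k)\in\mathfrak S$: $q_n=\max\{k:s_k\le nh_n\}$, $M_{l,k}=\#\{i:\sup I_i^l\in(s_{k-1},s_k]\}$, and $\mathcal E^l_{(k)}$ is the $M_l\times M_l$ diagonal matrix with $i$th diagonal entry $1$ if $\sup I_i^l\in(s_{k-1},s_k]$ and $0$ otherwise. $\mathcal N^{n,l}_t=\sum_{i=1}^{M_l}1_{\{S_i^{n,l}\le t\}}$. Mixing coefficients: $\mathcal G^n_{i,j}=\sigma(\mathcal N^{n,l}_t-\mathcal N^{n,l}_s;\ ih_n\le s<t\le jh_n,\ l=1,2)$ for $0\le i,j\le n$, and $$\alpha_k^n=0\vee\sup_{1\le i,j\le n-1,\ j-i\ge k}\ \sup_{A\in\mathcal G^n_{0,i}}\ \sup_{B\in\mathcal G^n_{j,n}}|P(A\cap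 B)-P(A)P(B)|.$$ $\mathbb N=\{1,2,\dots\}$. *)

(* Defs.v *)
From HB Require Import structures.
From mathcomp Require Import all_boot all_order all_algebra.
From mathcomp Require Import all_classical all_reals all_analysis.

Set Implicit Arguments.
Unset Strict Implicit.
Unset Printing Implicit Defensive.

Import Order.TTheory GRing.Theory Num.Theory.
Import numFieldNormedType.Exports.

Local Open Scope classical_set_scope.
Local Open Scope ring_scope.

(* The set S of partitions of [0, +oo[; they are automatically unbounded,
   since the infimum of the mesh is positive. *)
Definition partitions (R : realType) : set (nat -> R) :=
  [set s | [/\ s 0%N = 0,
      forall k, s k < s k.+1,
      (ereal_sup [set `|s k - s k.-1|%:E | k in [set k | (0 < k)%N]] <= 1%:E)%E
    & (0%:E < ereal_inf [set `|s k - s k.-1|%:E | k in [set k | (0 < k)%N]])%E]].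

(* max {k | s k <= t}; the default value 0 is never used when 0 <= t and s is
   a member of [partitions]. *)
Definition last_index (R : realType) (s : nat -> R) (t : R) : nat :=
  xget 0%N [set k | s k <= t /\ forall j, s j <= t -> (j <= k)%N].

Definition len (R : realType) (A : set R) : R :=
  fine (lebesgue_measure A).

Section convergence.
Context (d : measure_display) (T : measurableType d) (R : realType).
Context (P : probability T R).

Definition tight (I : Type) (D : set I) (X : I -> T -> R) : Prop :=
  forall eps : R, 0 < eps ->
    exists K : R, forall i, D i -> (P [set w | (K < `|X i w|)%R] <= eps%:E)%E.

Definition cvg0_in_probability (X : nat -> T -> R) : Prop :=
  forall eps : R, 0 < eps ->
    (fun n => P [set w | eps < `|X n w|]) @ \oo --> 0%E.

End convergence.

(* Families are indexed by n : nat, but only the indices n >= 1 matter.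
   The superscripts l = 1, 2 are ord0 and ord_max in 'I_2.
   S n l i is meaningful for i <= M n l only; its values beyond that index are
   an arbitrary measurable extension and are never used. *)
Section sampling.
Context (d : measure_display) (T : measurableType d) (R : realType).
Context (P : probability T R).
Context (h : nat -> R).
Context (M : nat -> 'I_2 -> {RV P >-> nat}).
Context (S : nat -> 'I_2 -> nat -> {RV P >-> R}).

Definition horizon (n : nat) : R := n%:R * h n.

Definition sampling_scheme : Prop :=
  forall n, (0 < n)%N -> forall (l : 'I_2) (w : T),
    [/\ (0 < M n l w)%N,
        S n l 0%N w = 0,
        forall i, (i < M n l w)%N -> S n l i w < S n l i.+1 w
      & S n l (M n l w) w = horizon n].

(* Indices are shifted: [obs_itv n l w i] is I_(i+1)^l. *)
Definition obs_itv (n : nat) (l : 'I_2) (w : T) (i : nat) : set R :=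
  `]S n l i w, S n l i.+1 w]%classic.

Definition Gmx (n : nat) (w : T) : 'M[R]_(M n ord0 w, M n ord_max w) :=
  \matrix_(i, j)
    (len (obs_itv n ord0 w i `&` obs_itv n ord_max w j) /
     (Num.sqrt (len (obs_itv n ord0 w i)) *
      Num.sqrt (len (obs_itv n ord_max w j)))).

Definition in_block (s : nat -> R) (k n : nat) (l : 'I_2) (w : T) (i : nat)
    : bool :=
  s k.-1 < sup (obs_itv n l w i) <= s k.

Definition block_count (s : nat -> R) (k n : nat) (l : 'I_2) (w : T) : nat :=
  #|[set i : 'I_(M n l w) | in_block s k n l w i]|.

Definition block_diag_mx (s : nat -> R) (k n : nat) (l : 'I_2) (w : T)
    : 'M[R]_(M n l w) :=
  diag_mx (\row_(i < M n l w) (in_block s k n l w i)%:R).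

Definition block_trace (s : nat -> R) (k n p : nat) (w : T) : R :=
  \tr (block_diag_mx s k n ord0 w *m (Gmx n w *m (Gmx n w)^T) ^+ p).

Definition nblocks (s : nat -> R) (n : nat) : nat := last_index s (horizon n).

(* The maxima run over absolute values, so 0 is neutral; it is also the value
   given to the maximum over the empty range, when nblocks s n = 0. *)
Definition condA4 (a0 : 'I_2 -> R) (a : nat -> R) : Prop :=
  [/\ forall l, 0 < a0 l,
      forall l s, partitions s ->
        tight P [set n | (0 < n)%N]
          (fun n w => h n * (block_count s (nblocks s n).+1 n l w)%:R) /\
        cvg0_in_probability P (fun n w =>
          \big[Num.max/0]_(1 <= k < (nblocks s n).+1)
            `|h n * (block_count s k n l w)%:R - a0 l * (s k - s k.-1)|)
    & forall p, (0 < p)%N -> 0 <= a p /\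
        forall s, partitions s ->
          cvg0_in_probability P (fun n w =>
            \big[Num.max/0]_(1 <= k < (nblocks s n).+1)
              `|h n * block_trace s k n p w - a p * (s k - s k.-1)|)].

(* The counting process N^{n,l}, with real values so that increments are true
   differences. *)
Definition counting_process (n : nat) (l : 'I_2) (t : R) (w : T) : R :=
  \sum_(1 <= i < (M n l w).+1) (S n l i w <= t)%R%:R.

Definition increment (n : nat) (l : 'I_2) (s t : R) (w : T) : R :=
  counting_process n l t w - counting_process n l s w.

Definition condB2 (q : R) : Prop :=
  (limf_esup (fun u : R =>
     ereal_sup [set
       \big[maxe/-oo]_(l < 2)
         ereal_sup [set (u `^ q)%:E *
                        P [set w | increment n l t (t + u * h n) w = 0%R]
                   | t in `[0%R, (n%:R * h n - u * h n)%R]%classic]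
       | n in [set n | (0 < n)%N]])
     (pinfty_nbhs R) < +oo)%E.

Definition tight_increments : Prop :=
  tight P
    [set x : nat * 'I_2 * R |
      (0 < x.1.1)%N /\ 0 <= x.2 <= horizon x.1.1 - h x.1.1]
    (fun x => increment x.1.1 x.1.2 x.2 (x.2 + h x.1.1)).

Definition increment_sigma (n i j : nat) : set (set T) :=
  <<s \bigcup_(x in [set x : 'I_2 * R * R |
                 [/\ i%:R * h n <= x.1.2, x.1.2 < x.2 & x.2 <= j%:R * h n]])
        preimage_set_system setT (increment n x.1.1 x.1.2 x.2) measurable >>.

Definition mixing_coef (n k : nat) : \bar R :=
  maxe (0 : \bar R) (ereal_sup [set
    ereal_sup [set
      ereal_sup [set `|P (A `&` B) - P A * P B|
                | B in increment_sigma n ij.2 n]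
      | A in increment_sigma n 0 ij.1]
    | ij in [set ij : nat * nat |
        [/\ (1 <= ij.1 <= n.-1)%N, (1 <= ij.2 <= n.-1)%N
          & (ij.1 + k <= ij.2)%N]]])%E.

Definition summable_mixing : Prop :=
  forall n, (0 < n)%N ->
    (\sum_(1 <= k <oo) k%:R%:E * mixing_coef n k < +oo)%E.

End sampling.

(* Main.v *)
Require Import Defs.
From HB Require Import structures.
From mathcomp Require Import all_boot all_order all_algebra.
From mathcomp Require Import all_classical all_reals all_analysis.
From mathcomp Require Import measurable_realfun.
From mathcomp Require Import ring lra.
Set Implicit Arguments.
Unset Strict Implicit.
Unset Printing Implicit Defensive.
Import Order.TTheory GRing.Theory Num.Theory.
Import numFieldNormedType.Exports.
Local Open Scope classical_set_scope.
Local Open Scope ring_scope.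

(** Why [a 1 > 0]. For [p = 1], a block trace is the sum of the squared entries of
[G] over the rows of that block, so it suffices to exhibit, with a probability that
does not vanish, on the order of [1 / h n] entries bounded away from [0].  One
block is enough: take the partition [s j = j] and its first block, whose right end
is at most the horizon for [n] large.

Fix [u] so large that a stretch of length [u * h n] is free of observations with
probability at most [1/16] (condition B2), and [k] such that a stretch of length
[h n] holds more than [k] observations with probability at most [1/16]
(tightness of the increments).  Cut [(0, 1]] into [N] windows of length
[B = (u + 1 + u) * h n], and call a window good if, for both components, its first
and last stretch, of length [u * h n], contain an observation while its middle
stretch, of length [h n], contains at most [k].  Six events of probability [1/16]
are excluded, so a window is good with probability at least [1/2].

In a good window, cut the middle stretch into [2 * k + 1] equal pieces. At most
[2 * k] observations fall there, hence some piece meets none: it lies in one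
interval [I_i] of the first component and in one [J_j] of the second.  The
observations in the outer stretches keep [I_i] and [J_j] inside the window.
Therefore the entry [G_ij] is at least [1 / ((2 * k + 1) * (u + 1 + u))]
([window_cell], [cell_corr_ge]).  Distinct windows are disjoint and yield distinct
rows, so the contributions of the good windows add up ([block_trace_ge]).

A reverse Markov inequality ([reverse_markov_count]) shows that at least [N / 4]
windows are good with probability at least [1/4].  As [N * h n] is bounded below,
so is [h n * tr] on that event ([block_trace_prob]), whereas it would converge to
[0] in probability if [a 1] were [0]. *)

(** * Counting the points of one strictly increasing path *)

Section counting.
Context (R : realType) (m : nat) (x : nat -> R).
Context (x_lt : forall i, (i < m)%N -> x i < x i.+1).

(** [counting_process] at a fixed outcome, for one component. *)
Definition count_upto (t : R) : R := \sum_(1 <= i < m.+1) (x i <= t)%R%:R.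

Lemma path_lt i j : (i < j <= m)%N -> x i < x j.
Proof.
case/andP; elim: j => // j IHj; rewrite ltnS leq_eqVlt => /predU1P[->|ij] jm.
  exact: x_lt.
by apply: lt_trans (x_lt jm); apply: IHj => //; apply: ltnW.
Qed.

Lemma path_le i j : (i <= j <= m)%N -> x i <= x j.
Proof.
case/andP; rewrite leq_eqVlt => /predU1P[->//|ij] jm.
by apply/ltW/path_lt/andP.
Qed.

Lemma path_lt_inv i j : (i <= m)%N -> x i < x j -> (i < j)%N.
Proof.
move=> im xij; rewrite ltnNge; apply/negP => ji.
by move: xij; rewrite ltNge path_le // ji.
Qed.

Lemma count_uptoB s t : s <= t ->
  count_upto t - count_upto s = \sum_(1 <= i < m.+1) (s < x i <= t)%R%:R.
Proof.
move=> st; rewrite /count_upto -sumrB; apply: eq_bigr => i _.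
rewrite ltNge; case: (leP (x i) s) => [xs|sx] /=; last by rewrite subr0.
by rewrite (le_trans xs st) subrr.
Qed.

Lemma count_upto_neq0 s t : s <= t -> count_upto t - count_upto s != 0 ->
  exists2 j, (0 < j <= m)%N & s < x j <= t.
Proof.
move=> st; rewrite count_uptoB //; apply: contra_neqP => nj.
rewrite big_nat big1 // => i /andP[i0 im].
case: (boolP (s < x i <= t)) => // xi; exfalso.
by apply: nj; exists i => //; rewrite i0.
Qed.

Lemma count_upto_ge1 s t j : s <= t -> (0 < j <= m)%N -> s < x j <= t ->
  1 <= count_upto t - count_upto s.
Proof.
move=> st jm sxt; rewrite count_uptoB // (big_rem j) /= ?mem_index_iota //.
by rewrite sxt lerDl sumr_ge0.
Qed.

(** Increments are natural numbers; this dichotomy is the only consequence of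
integrality that the pigeonhole argument needs. *)
Lemma count_upto_0V1 s t : s <= t ->
  count_upto t - count_upto s = 0 \/ 1 <= count_upto t - count_upto s.
Proof.
move=> st; have [->|ne] := eqVneq (count_upto t - count_upto s) 0; first by left.
by right; have [j jm sxt] := count_upto_neq0 st ne; apply: count_upto_ge1 sxt.
Qed.

(** The interval is the one whose left end is the last point up to [a]: its right
end exceeds [a], and it cannot fall in [(a, b]]. *)
Lemma empty_gap_cell a b : x 0%N <= a -> a <= b -> b <= x m ->
    a < x m -> count_upto b - count_upto a = 0 ->
  exists2 i, (i < m)%N & x i <= a /\ b <= x i.+1.
Proof.
move=> x0a ab bm am ab0.
have [i /andP[im xia] imax] : {i | (i <= m)%N && (x i <= a)
    & forall j, (j <= m)%N && (x j <= a) -> (j <= i)%N}.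
  have ex : exists i, (i <= m)%N && (x i <= a) by exists 0%N.
  have bd i : (i <= m)%N && (x i <= a) -> (i <= m)%N by case/andP.
  by case: (ex_maxnP ex bd) => i; exists i.
have {}im : (i < m)%N.
  rewrite ltn_neqAle im andbT; apply: contraTneq xia => ->.
  by rewrite -ltNge.
exists i => //; split=> //; rewrite leNgt; apply/negP => xb.
have ax : a < x i.+1.
  rewrite ltNge; apply/negP => xa.
  by have := imax i.+1; rewrite im xa ltnn => /(_ isT).
have := @count_upto_ge1 a b i.+1 ab im; rewrite ax ltW // => /(_ isT).
by rewrite ab0 ler10.
Qed.

End counting.

(** * An entry of the correlation matrix from a good window *)

(** If no piece were free of both kinds of points, each of the [2 * k + 1] pieces
would carry at least one unit of the total increment, which is at most [2 * k]. *)
Lemma pigeonhole_increments (R : realFieldType) (f g : nat -> R) (k : nat) :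
    (forall r, f r.+1 - f r = 0 \/ 1 <= f r.+1 - f r) ->
    (forall r, g r.+1 - g r = 0 \/ 1 <= g r.+1 - g r) ->
    f k.*2.+1 - f 0%N <= k%:R -> g k.*2.+1 - g 0%N <= k%:R ->
  exists2 r, (r <= k.*2)%N & f r.+1 - f r = 0 /\ g r.+1 - g r = 0.
Proof.
move=> f01 g01 fk gk; apply: contrapT => noempty.
have : (k.*2.+1)%:R <=
    \sum_(0 <= r < k.*2.+1) ((f r.+1 - f r) + (g r.+1 - g r)).
  rewrite -[k.*2.+1 in leLHS]subn0 -sumr_const_nat.
  rewrite big_nat [leRHS]big_nat; apply: ler_sum => r rk.
  case: (f01 r) (g01 r) => [f0|f1] [g0|g1]; try lra.
  by exfalso; apply: noempty; exists r.
have -> : (k.*2.+1)%:R = k%:R + k%:R + 1 :> R.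
  by rewrite -addn1 -addnn !natrD.
by rewrite big_split /= !telescope_sumr //; lra.
Qed.

(** The pigeonhole argument in the middle stretch gives a piece, starting at [a],
that is free of points of both components, hence covered by one interval of each.
The points of the two outer stretches stop these intervals inside the window. *)
Lemma window_cell (R : realType) (m : 'I_2 -> nat) (x : 'I_2 -> nat -> R)
    (k : nat) (b v e T : R) :
    (forall l, [/\ (0 < m l)%N, x l 0%N = 0,
      forall i, (i < m l)%N -> x l i < x l i.+1 & x l (m l) = T]) ->
    0 <= b -> 0 < v -> 0 < e -> b + v + e + v <= T ->
    (forall l, [/\ count_upto (m l) (x l) (b + v) - count_upto (m l) (x l) b != 0,
      count_upto (m l) (x l) (b + v + e) - count_upto (m l) (x l) (b + v) <= k%:R &
      count_upto (m l) (x l) (b + v + e + v)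
        - count_upto (m l) (x l) (b + v + e) != 0]) ->
  exists a, forall l, exists2 i, (i < m l)%N &
    [/\ b < x l i, x l i <= a, a + e / k.*2.+1%:R <= x l i.+1
      & x l i.+1 <= b + v + e + v].
Proof.
move=> xP b0 v0 e0 bT good.
pose dl := e / k.*2.+1%:R.
have dl0 : 0 < dl by rewrite divr_gt0.
have dlE : k.*2.+1%:R * dl = e by rewrite /dl mulrC divfK.
pose pt r := b + v + r%:R * dl.
have ptS r : pt r.+1 = pt r + dl by rewrite /pt -addn1 natrD mulrDl mul1r addrA.
have pt0 : pt 0%N = b + v by rewrite /pt mul0r addr0.
have ptk : pt k.*2.+1 = b + v + e by rewrite /pt dlE.
pose f l r := count_upto (m l) (x l) (pt r).
have f01 l r : f l r.+1 - f l r = 0 \/ 1 <= f l r.+1 - f l r.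
  by apply: count_upto_0V1; rewrite ptS lerDl ltW.
have fk l : f l k.*2.+1 - f l 0%N <= k%:R.
  by rewrite /f ptk pt0; case: (good l).
have [r rk [r0 r1]] :=
  pigeonhole_increments (f01 ord0) (f01 ord_max) (fk ord0) (fk ord_max).
have ptr0 : b + v <= pt r by rewrite /pt lerDl mulr_ge0 // ltW.
have ptr1 : pt r + dl <= b + v + e.
  by rewrite -ptS -ptk /pt lerD2l ler_wpM2r ?ler_nat // ltW.
exists (pt r) => l.
have rl0 : f l r.+1 - f l r = 0.
  have : l \in [:: ord0; ord_max].
    by case: l => [[|[|//]]] ?; rewrite !inE -!val_eqE.
  by rewrite !inE => /orP[]/eqP->.
have [m0 x0 xlt xm] := xP l.
have [||||i im [xi xi1]] := @empty_gap_cell _ (m l) (x l) (pt r) (pt r.+1) _ _ _ _ rl0.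
- by rewrite x0; lra.
- by rewrite ptS; lra.
- by rewrite ptS xm; lra.
- by rewrite xm; lra.
have [ne1 _ ne2] := good l.
exists i => //; split => //.
- have [|j /andP[j0 jm] /andP[bxj xjb]] := count_upto_neq0 _ ne1; first lra.
  apply: lt_le_trans bxj _; apply: (path_le xlt).
  rewrite (ltnW im) andbT -ltnS; apply: (path_lt_inv xlt) => //.
  by move: xi1; rewrite ptS; lra.
- by rewrite -ptS.
- have [|j /andP[j0 jm] /andP[bxj xjb]] := count_upto_neq0 _ ne2; first lra.
  apply: le_trans xjb; apply: (path_le xlt).
  rewrite jm andbT; apply: (path_lt_inv xlt); first exact: ltnW.
  by lra.
Qed.

(** * Measurability and a reverse Markov inequality *)

Section measurability.
Context (d : measure_display) (T : measurableType d) (R : realType).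

(** For sums with a random number of terms. *)
Lemma measurable_nat_pick (X : T -> nat) (f : nat -> T -> R) :
    measurable_fun setT X -> (forall k, measurable_fun setT (f k)) ->
  measurable_fun setT (fun w => f (X w) w).
Proof.
move=> mX mf _ B mB; rewrite setTI.
have -> : (fun w => f (X w) w) @^-1` B =
    \bigcup_k ((X @^-1` [set k]) `&` (f k @^-1` B)).
  by apply/seteqP; split=> [w /= Bw|w [k _ [/= <-//]]]; exists (X w).
apply: bigcupT_measurable => k; apply: measurableI.
- by rewrite -[X in measurable X]setTI; apply: mX.
- by rewrite -[X in measurable X]setTI; apply: mf.
Qed.

Lemma measurable_natr_bool (b : T -> bool) :
  measurable_fun setT b -> measurable_fun setT (fun w => (b w)%:R : R).
Proof.
move=> mb; rewrite [X in measurable_fun _ X](_ : _ = fun w => if b w then 1 else 0).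
  by apply: measurable_fun_ifT => //; apply: measurable_cst.
by apply/funext => w; case: (b w).
Qed.

Lemma measurable_bigmax (I : Type) (s : seq I) (f : I -> T -> R) :
    (forall i, measurable_fun setT (f i)) ->
  measurable_fun setT (fun w => \big[Num.max/0]_(i <- s) f i w).
Proof.
move=> mf; elim: s => [|i s IHs].
  by rewrite [X in measurable_fun _ X](_ : _ = cst 0);
    [exact: measurable_cst|apply/funext => w; rewrite big_nil].
rewrite [X in measurable_fun _ X](_ : _ =
    fun w => Num.max (f i w) (\big[Num.max/0]_(j <- s) f j w)).
  exact: measurable_maxr.
by apply/funext => w; rewrite big_cons.
Qed.

Lemma measurable_norm_gt (f : T -> R) (K : R) :
  measurable_fun setT f -> measurable [set w | K < `|f w|].
Proof.
move=> mf; rewrite (_ : [set w | _] = ~` (setT `&` [set w | `|f w| <= K])).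
  by apply: measurableC; apply: measurable_fun_le => //; exact: measurableT_comp.
rewrite setTI; apply/seteqP; split=> w /=; first by rewrite ltNge => /negP.
by move=> /negP; rewrite -ltNge.
Qed.

Lemma measurable_sqrtr (f : T -> R) :
  measurable_fun setT f -> measurable_fun setT (fun w => Num.sqrt (f w)).
Proof.
move=> mf; apply: (measurableT_comp _ mf).
by apply: continuous_measurable_fun => x; exact: sqrt_continuous.
Qed.

Lemma measurable_invr_ge0 (f : T -> R) : (forall w, 0 <= f w) ->
  measurable_fun setT f -> measurable_fun setT (fun w => (f w)^-1).
Proof.
move=> f0 mf.
rewrite [X in measurable_fun _ X](_ : _ = (@powR R ^~ (-1)) \o f).
  by apply: measurableT_comp => //; apply: measurable_powR.
by apply/funext => w /=; rewrite powR_inv1.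
Qed.

(** The number of events that occur is at most [N] on the event in the conclusion
and at most [N * p] off it, while its mean is at least [N * (2 * p)]. *)
Lemma reverse_markov_count (P : probability T R) (N : nat) (E : 'I_N -> set T)
    (p : R) :
    (0 < N)%N -> 0 <= p -> (forall m, measurable (E m)) ->
    (forall m, ((p + p)%:E <= P (E m))%E) ->
  (p%:E <= P [set w | (N%:R * p <= \sum_(m < N) \1_(E m) w)%R])%E.
Proof.
move=> N0 p0 mE PE; set F := [set w | _].
have N0r : 0 < N%:R :> R by rewrite ltr0n.
have msum : measurable_fun setT (fun w => \sum_(m < N) \1_(E m) w : R).
  by apply: measurable_sum => m; apply: measurable_indic.
have mF : measurable F.
  rewrite (_ : F = setT `&` [set w | cst (N%:R * p) w <= \sum_(m < N) \1_(E m) w]).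
    exact: measurable_fun_le.
  by rewrite setTI.
have intE : (\int[P]_w (\sum_(m < N) (\1_(E m) w)%:E) = \sum_(m < N) P (E m))%E.
  rewrite ge0_integral_sum //.
  - by apply: eq_bigr => m _; rewrite integral_indic // setIT.
  - by move=> m; apply/measurable_EFinP; apply: measurable_indic.
have intle : (\int[P]_w (\sum_(m < N) (\1_(E m) w)%:E)
    <= \int[P]_w ((N%:R * p)%:E + (N%:R%:E * (\1_F w)%:E)))%E.
  apply: ge0_le_integral => //.
  - by move=> w _; apply: sume_ge0 => m _; rewrite lee_fin.
  - by apply: emeasurable_sum => m; apply/measurable_EFinP; apply: measurable_indic.
  - apply: emeasurable_funD; first exact: measurable_cst.
    apply: measurable_funeM; apply/measurable_EFinP; exact: measurable_indic.
  move=> w _; rewrite sumEFin -EFinM -EFinD lee_fin.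
  have le1 m : \1_(E m) w <= 1 :> R by rewrite indicE; case: (_ \in _).
  have [wF|wF] := pselect (F w).
    rewrite [\1_F w]indicE mem_set // mulr1.
    apply: (@le_trans _ _ (\sum_(m < N) 1)); first exact: ler_sum.
    by rewrite sumr_const card_ord lerDr mulr_ge0.
  rewrite [\1_F w]indicE memNset // mulr0 addr0 ltW // ltNge; exact/negP.
rewrite intE in intle.
have [x PF] : exists x, P F = x%:E.
  by exists (fine (P F)); rewrite fineK // fin_num_measure.
move: intle; rewrite ge0_integralD //; first last.
- by apply: measurable_funeM; apply/measurable_EFinP; exact: measurable_indic.
- by move=> w _; rewrite lee_fin mulr_ge0.
rewrite integral_cst //= probability_setT mule1.
rewrite ge0_integralZl_EFin //; last first.
  by apply/measurable_EFinP; exact: measurable_indic.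
rewrite integral_indic // setIT => intle.
have {intle} : (\sum_(m < N) (p + p)%:E <= (N%:R * p)%:E + N%:R%:E * P F)%E.
  by apply: le_trans intle; apply: lee_sum.
rewrite PF -EFinM -EFinD.
rewrite sumEFin sumr_const card_ord !lee_fin -[leLHS]mulr_natl.
by rewrite mulrDr lerD2l ler_pM2l.
Qed.

End measurability.

(** * Block traces bounded below by good cells *)

Section trace.
Context (R : realType).

Lemma len_itv_oc (a b : R) : len `]a, b] = Num.max 0 (b - a).
Proof.
rewrite /len lebesgue_measure_itv /= lte_fin; case: ltP => ab.
  by rewrite -EFinB /= max_r // subr_ge0 ltW.
by rewrite /= max_l // subr_le0.
Qed.

Lemma itv_ocI (a b a' b' : R) :
  `]a, b] `&` `]a', b'] = `]Num.max a a', Num.min b b']%classic.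
Proof.
apply/seteqP; split=> y /=; rewrite !in_itv /= gt_max le_min.
  by move=> [/andP[-> ->] /andP[-> ->]].
by move=> /andP[/andP[-> ->] /andP[-> ->]].
Qed.

Lemma ler_sum_inj (I J : finType) (A : {set I}) (f : I -> J) (F : J -> R)
    (c : R) :
    {in A &, injective f} -> (forall j, 0 <= F j) ->
    (forall i, i \in A -> c <= F (f i)) ->
  #|A|%:R * c <= \sum_j F j.
Proof.
move=> finj F0 cF; rewrite (bigID (mem (f @: A))) /=.
rewrite -[leLHS]addr0 lerD ?sumr_ge0 // big_imset //=.
by rewrite mulr_natl -sumr_const; apply: ler_sum.
Qed.

End trace.

Section block_trace.
Context (d : measure_display) (T : measurableType d) (R : realType).
Context (P : probability T R) (h : nat -> R).
Context (M : nat -> 'I_2 -> {RV P >-> nat}).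
Context (S : nat -> 'I_2 -> nat -> {RV P >-> R}).

(** The entries of [Gmx], with indices in [nat]: the dimensions of [Gmx] depend on
the outcome, which excludes treating its entries as random variables. *)
Definition cell_corr (n : nat) (w : T) (i j : nat) : R :=
  len (obs_itv S n ord0 w i `&` obs_itv S n ord_max w j) /
  (Num.sqrt (len (obs_itv S n ord0 w i)) *
   Num.sqrt (len (obs_itv S n ord_max w j))).

Lemma block_trace1E s k n w : block_trace M S s k n 1 w =
  \sum_(i < M n ord0 w) \sum_(j < M n ord_max w)
    (in_block S s k n ord0 w i)%:R * cell_corr n w i j ^+ 2.
Proof.
rewrite /block_trace expr1 /mxtrace; apply: eq_bigr => i _.
rewrite /block_diag_mx mul_diag_mx !mxE big_distrr /=.
by apply: eq_bigr => j _; rewrite !mxE expr2.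
Qed.

Lemma in_blockE s k n l w i : S n l i w < S n l i.+1 w ->
  in_block S s k n l w i = (s k.-1 < S n l i.+1 w <= s k).
Proof. by move=> Slt; rewrite /in_block /obs_itv sup_itv // bnd_simp. Qed.

(** The intersection contains [(a, a + delta]], and the normalization is at most
[sqrt B * sqrt B]. *)
Lemma cell_corr_ge n w i j (delta B a : R) : 0 < delta ->
    S n ord0 i w <= a -> a + delta <= S n ord0 i.+1 w ->
    S n ord0 i.+1 w - S n ord0 i w <= B ->
    S n ord_max j w <= a -> a + delta <= S n ord_max j.+1 w ->
    S n ord_max j.+1 w - S n ord_max j w <= B ->
  delta / B <= cell_corr n w i j.
Proof.
move=> delta0 i0 i1 iB j0 j1 jB.
rewrite /cell_corr /obs_itv itv_ocI !len_itv_oc.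
set c0 := S n ord0 i w in i0 iB *; set c1 := S n ord0 i.+1 w in i1 iB *.
set d0 := S n ord_max j w in j0 jB *; set d1 := S n ord_max j.+1 w in j1 jB *.
have B0 : 0 < B by lra.
rewrite (@max_r _ _ 0 (c1 - c0)); last lra.
rewrite (@max_r _ _ 0 (d1 - d0)); last lra.
have lenI : delta <= Num.max 0 (Num.min c1 d1 - Num.max c0 d0).
  have min_ge : a + delta <= Num.min c1 d1 by rewrite le_min i1 j1.
  have max_le : Num.max c0 d0 <= a by rewrite ge_max i0 j0.
  rewrite le_max; apply/orP; right; lra.
have sqrt_le : Num.sqrt (c1 - c0) * Num.sqrt (d1 - d0) <= B.
  rewrite -[leRHS]sqr_sqrtr ?(ltW B0) // expr2.
  by apply: ler_pM; rewrite ?sqrtr_ge0 ?ler_wsqrtr.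
have sqrt_gt : 0 < Num.sqrt (c1 - c0) * Num.sqrt (d1 - d0).
  by rewrite mulr_gt0 // sqrtr_gt0; lra.
apply: ler_pM => //; first exact: ltW.
- by rewrite invr_ge0 ltW.
- by rewrite lef_pV2 // posrE.
Qed.

Context (samplingMS : sampling_scheme h M S).

(** The right end of the row interval of the window [m] lies in
[(m * B, (m + 1) * B]]. Hence distinct windows have distinct rows, and each of
these rows belongs to the first block and has a large squared entry. *)
Lemma block_trace_ge s n w (N : nat) (W : {set 'I_N}) (B delta : R) :
    (0 < n)%N -> 0 < B -> 0 < delta -> s 0%N = 0 -> N%:R * B <= s 1%N ->
    (forall m, m \in W -> exists a, forall l,
      exists2 i, (i < M n l w)%N &
        [/\ m%:R * B < S n l i w, S n l i w <= a, a + delta <= S n l i.+1 w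
          & S n l i.+1 w <= m.+1%:R * B]) ->
  #|W|%:R * (delta / B) ^+ 2 <= block_trace M S s 1 n 1 w.
Proof.
move=> n0 B0 delta0 s0 NB cellP; rewrite block_trace1E.
have [M0 _ Slt _] := samplingMS n0 ord0 w.
have : forall m, exists i : 'I_(M n ord0 w), m \in W ->
    m%:R * B < S n ord0 i.+1 w <= m.+1%:R * B /\
    (delta / B) ^+ 2 <= \sum_(j < M n ord_max w)
      (in_block S s 1 n ord0 w i)%:R * cell_corr n w i j ^+ 2.
  move=> m; have [mW|mW] := boolP (m \in W); last by exists (Ordinal M0).
  have [a cell] := cellP _ mW.
  have [i iM [bi ia ai ib]] := cell ord0.
  have [j jM [bj ja aj jb]] := cell ord_max.
  exists (Ordinal iM) => _ /=.
  have mB : m%:R * B >= 0 by rewrite mulr_ge0 // ltW.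
  have mSB : m.+1%:R * B = m%:R * B + B by rewrite -addn1 natrD mulrDl mul1r.
  have mSN : m.+1%:R * B <= N%:R * B by rewrite ler_pM2r // ler_nat ltn_ord.
  split; first by rewrite ib andbT (lt_trans bi) // Slt.
  rewrite in_blockE ?Slt //= s0.
  have -> : 0 < S n ord0 i.+1 w <= s 1%N by have := Slt _ iM; lra.
  rewrite (bigD1 (Ordinal jM)) //= mul1r.
  rewrite -[leLHS]addr0 lerD ?sumr_ge0 //; last by move=> *; rewrite mul1r sqr_ge0.
  rewrite lerXn2r ?nnegrE //; first by rewrite divr_ge0 // ltW.
    apply: (@le_trans _ _ (delta / B)); first by rewrite divr_ge0 // ltW.
    by apply: (cell_corr_ge (a := a)) => //; lra.
  by apply: (cell_corr_ge (a := a)) => //; lra.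
case/choice => f fP; apply: (@ler_sum_inj R _ _ _ f) => //.
- move=> m m' mW m'W ff; apply/val_inj/eqP; rewrite eqn_leq.
  have [/andP[lo hi] _] := fP _ mW; have [/andP[lo' hi'] _] := fP _ m'W.
  rewrite ff in lo hi.
  have lt_index (p r : nat) y : p%:R * B < y -> y <= r.+1%:R * B -> (p <= r)%N.
    by move=> py yr; rewrite -ltnS -(ltr_nat R) -(ltr_pM2r B0) (lt_le_trans py).
  by rewrite (lt_index _ _ _ lo hi') (lt_index _ _ _ lo' hi).
- by move=> i; apply: sumr_ge0 => j _; rewrite mulr_ge0 // sqr_ge0.
- by move=> m /fP[].
Qed.

Lemma measurable_counting n l t :
  measurable_fun setT (counting_process M S n l t).
Proof.
rewrite /counting_process.
apply: (@measurable_nat_pick _ _ _ (M n l)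
  (fun k w => \sum_(1 <= i < k.+1) (S n l i w <= t)%R%:R)) => // k.
apply: measurable_sum => i; apply: measurable_natr_bool.
by apply: measurable_fun_ler => //; apply: measurable_cst.
Qed.

Lemma measurable_increment n l s t :
  measurable_fun setT (increment M S n l s t).
Proof. by apply: measurable_funB; apply: measurable_counting. Qed.

Lemma measurable_cell_corr n i j :
  measurable_fun setT (fun w => cell_corr n w i j).
Proof.
have mlen l k : measurable_fun setT (fun w => len (obs_itv S n l w k)).
  under eq_fun do rewrite /obs_itv len_itv_oc.
  by apply: measurable_maxr; [exact: measurable_cst|exact: measurable_funB].
apply: measurable_funM.
  under eq_fun do rewrite /obs_itv itv_ocI len_itv_oc.
  apply: measurable_maxr; first exact: measurable_cst.
  by apply: measurable_funB; [exact: measurable_minr|exact: measurable_maxr].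
apply: measurable_invr_ge0; first by move=> w; rewrite mulr_ge0 ?sqrtr_ge0.
by apply: measurable_funM; apply: measurable_sqrtr.
Qed.

(** At a fixed pair of dimensions the trace is an explicit expression in the
observation times; the dimensions are then randomized one after the other. *)
Lemma measurable_block_trace s k n : (0 < n)%N ->
  measurable_fun setT (block_trace M S s k n 1).
Proof.
move=> n0; pose g m m' w := \sum_(i < m) \sum_(j < m')
  (s k.-1 < S n ord0 i.+1 w <= s k)%R%:R * cell_corr n w i j ^+ 2.
rewrite [X in measurable_fun _ X](_ : _ =
    fun w => g (M n ord0 w) (M n ord_max w) w); last first.
  apply/funext => w; rewrite block_trace1E; apply: eq_bigr => i _.
  have [_ _ Slt _] := samplingMS n0 ord0 w.
  by apply: eq_bigr => j _; rewrite in_blockE ?Slt.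
apply: (@measurable_nat_pick _ _ _ (M n ord0)
  (fun m w => g m (M n ord_max w) w)) => // m.
apply: measurable_nat_pick => // m'.
apply: measurable_sum => i; apply: measurable_sum => j.
apply: measurable_funM.
  apply: measurable_natr_bool; apply: measurable_and.
  - by apply: measurable_fun_ltr => //; exact: measurable_cst.
  - by apply: measurable_fun_ler => //; exact: measurable_cst.
by apply: measurable_funX; exact: measurable_cell_corr.
Qed.

End block_trace.

(** * Good windows are likely *)

Section probability_estimates.
Context (d : measure_display) (T : measurableType d) (R : realType).
Context (P : probability T R) (h : nat -> R).
Context (M : nat -> 'I_2 -> {RV P >-> nat}).
Context (S : nat -> 'I_2 -> nat -> {RV P >-> R}).

Lemma measurable_increment_eq0 n l s t :
  measurable [set w | increment M S n l s t w = 0].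
Proof.
rewrite -[X in measurable X]setTI.
exact: (measurable_increment M S n l s t _ (measurable_set1 0)).
Qed.

Lemma measurable_increment_le n l s t (K : R) :
  measurable [set w | increment M S n l s t w <= K].
Proof.
rewrite -[X in measurable X]setTI; apply: measurable_fun_le => //.
exact: measurable_increment.
Qed.

(** If [u `^ q * P] is at most [C] for all large [u], then [P] is at most [eps] as
soon as [u] is also at least [(C / eps) `^ (1 / q)]. *)
Lemma condB2_small q eps : 0 < q -> 0 < eps -> condB2 h M S q ->
  exists2 u : R, 0 < u & forall n l t, (0 < n)%N ->
    0 <= t <= horizon h n - u * h n ->
    (P [set w | increment M S n l t (t + u * h n) w = 0%R] <= eps%:E)%E.
Proof.
move=> q0 e0; rewrite /condB2 /limf_esup.
move=> /ereal_inf_lt[_ [V [A [_ VA]]] <- supVy].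
set f := fun u : R => _ in supVy *.
have [C C0 supC] : exists2 C : R, 0 <= C & (ereal_sup (f @` V) <= C%:E)%E.
  move: supVy; case: (ereal_sup _) => [r| |] // _.
  - by exists `|r|; rewrite // lee_fin ler_norm.
  - by exists 0; rewrite // leNye.
pose u := Num.max (A + 1) (Num.max 1 ((C / eps) `^ q^-1)).
have uA : A < u by rewrite lt_max ltrDl ltr01.
have u0 : 0 < u by rewrite !lt_max ltr01 orbT.
have uq : C / eps <= u `^ q.
  rewrite -{1}(@powRr1 _ (C / eps)) ?divr_ge0 ?(ltW e0) //.
  rewrite -(@mulVf _ q) ?gt_eqF // powRrM.
  apply: ge0_ler_powR; rewrite ?nnegrE ?powR_ge0 ?(ltW q0) ?(ltW u0) //.
  by rewrite !le_max lexx !orbT.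
exists u => // n l t n0 tn.
have fu : (f u <= C%:E)%E.
  by apply: le_trans supC; apply: ereal_sup_ubound; exists u => //; apply: VA.
set p := P _; have : ((u `^ q)%:E * p <= C%:E)%E.
  apply: le_trans fu; apply: le_trans (ereal_sup_ubound _); last by exists n.
  apply: le_trans (@le_bigmax _ _ _ _ _ l); apply: ereal_sup_ubound.
  by exists t => //=; rewrite in_itv.
have -> : p = (fine p)%:E
  by rewrite fineK // fin_num_measure //; exact: measurable_increment_eq0.
rewrite -EFinM !lee_fin => up.
have u_gt0 : 0 < u `^ q by rewrite powR_gt0.
rewrite -(ler_pM2l u_gt0) (le_trans up) //.
by rewrite -ler_pdivrMr.
Qed.

Definition good_window (n k : nat) (b v : R) : set T :=
  [set w | forall l, [/\ increment M S n l b (b + v) w != 0,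
    increment M S n l (b + v) (b + v + h n) w <= k%:R &
    increment M S n l (b + v + h n) (b + v + h n + v) w != 0]].

(** The complement is covered by six events of probability at most [1/16]: for each
component, an outer stretch without points (twice) or a crowded middle stretch. *)
Lemma good_window_prob (n k : nat) (K b u : R) : (0 < n)%N -> 0 < h n ->
    0 < u -> K <= k%:R -> 0 <= b -> b + u * h n + h n + u * h n <= horizon h n ->
    (forall l t, 0 <= t <= horizon h n - u * h n ->
      (P [set w | increment M S n l t (t + u * h n) w = 0%R] <= 16^-1%:E)%E) ->
    (forall l t, 0 <= t <= horizon h n - h n ->
      (P [set w | (K < `|increment M S n l t (t + h n) w|)%R] <= 16^-1%:E)%E) ->
  measurable (good_window n k b (u * h n)) /\
  ((4^-1 + 4^-1)%:E <= P (good_window n k b (u * h n)))%E.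
Proof.
move=> n0 h0 u0 Kk b0 bT gaps crowd.
set v := u * h n in bT gaps *.
have v0 : 0 < v by rewrite mulr_gt0.
pose bad l := [set w | increment M S n l b (b + v) w = 0] `|`
  [set w | K < `|increment M S n l (b + v) (b + v + h n) w|] `|`
  [set w | increment M S n l (b + v + h n) (b + v + h n + v) w = 0].
have mbad l : measurable (bad l).
  by apply: measurableU; [apply: measurableU|];
    [exact: measurable_increment_eq0|exact/measurable_norm_gt/measurable_increment|
     exact: measurable_increment_eq0].
have Pbad l : (P (bad l) <= (16^-1 + 16^-1 + 16^-1)%:E)%E.
  rewrite !EFinD; apply: le_trans (measureU2 _ _ _) _.
  - by apply: measurableU;
      [exact: measurable_increment_eq0|exact/measurable_norm_gt/measurable_increment].
  - exact: measurable_increment_eq0.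
  apply: leeD; last by apply: gaps; lra.
  apply: le_trans (measureU2 _ _ _) _.
  - exact: measurable_increment_eq0.
  - exact/measurable_norm_gt/measurable_increment.
  by apply: leeD; [apply: gaps|apply: crowd]; lra.
have mgood : measurable (good_window n k b v).
  rewrite (_ : good_window n k b v = \bigcap_(l in [set: 'I_2])
      (~` [set w | increment M S n l b (b + v) w = 0] `&`
      [set w | increment M S n l (b + v) (b + v + h n) w <= k%:R] `&`
      ~` [set w | increment M S n l (b + v + h n) (b + v + h n + v) w = 0])).
    apply: fin_bigcap_measurable => // l _.
    by apply: measurableI; [apply: measurableI|]; [apply: measurableC;
      exact: measurable_increment_eq0|exact: measurable_increment_le|
      apply: measurableC; exact: measurable_increment_eq0].
  apply/seteqP; split=> w gw l; have := gw l.
    by case=> /eqP ? ? /eqP ?; split.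
  by case=> // [[? ?] ?]; split=> //; apply/eqP.
split=> //.
have sub : ~` good_window n k b v `<=` bad ord0 `|` bad ord_max.
  move=> w; apply: contra_notP => /not_orP[nb0 nb1] l.
  have {nb0 nb1} : ~ bad l w.
    have : l \in [:: ord0; ord_max].
      by case: l => [[|[|//]]] ?; rewrite !inE -!val_eqE.
    by rewrite !inE => /orP[]/eqP->.
  move=> /not_orP[/not_orP[ne1 le2] ne3]; split; try exact/eqP.
  move/negP: le2; rewrite -leNgt => le2.
  by apply: le_trans (ler_norm _) _; apply: le_trans le2 _.
have : (P (~` good_window n k b v) <=
    ((16^-1 + 16^-1 + 16^-1) + (16^-1 + 16^-1 + 16^-1))%:E)%E.
  apply: (@le_trans _ _ (P (bad ord0 `|` bad ord_max))).
    by apply: le_measure; rewrite ?inE //; [exact: measurableC|exact: measurableU].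
  rewrite EFinD; apply: le_trans (measureU2 _ _ _) _ => //.
  by apply: leeD; exact: Pbad.
rewrite probability_setC //.
have [x ->] : exists x, P (good_window n k b v) = x%:E.
  by exists (fine (P (good_window n k b v))); rewrite fineK // fin_num_measure.
by rewrite -EFinB !lee_fin; lra.
Qed.

End probability_estimates.

(** * The first unit block *)

Lemma partitions_natr (R : realType) : partitions (fun k => k%:R : R).
Proof.
have step k : (0 < k)%N -> `|k%:R - k.-1%:R : R| = 1.
  by case: k => // k _; rewrite /= -natrB // subSnn normr1.
split=> //.
- by move=> k; rewrite ltr_nat.
- by apply: ge_ereal_sup => _ [k /= k0 <-]; rewrite step.
- by apply: (@lt_le_trans _ _ 1%:E); [rewrite lte_fin|
    apply: le_ereal_inf_tmp => _ [k /= k0 <-]; rewrite step].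
Qed.

Lemma nblocks_natr_gt0 (R : realType) (h : nat -> R) n :
  1 <= horizon h n -> (0 < nblocks h (fun k => k%:R) n)%N.
Proof.
move=> T1; rewrite /nblocks /last_index.
case: xgetP => [k _ [_ kmax]|noindex]; first exact: (kmax 1%N).
exfalso; apply: (noindex (Num.truncn (horizon h n))).
have T0 : 0 <= horizon h n by lra.
split; first by rewrite truncn_le.
by move=> j jT; rewrite truncn_ge_nat.
Qed.

Section trace_estimate.
Context (d : measure_display) (T : measurableType d) (R : realType).
Context (P : probability T R) (h : nat -> R).
Context (M : nat -> 'I_2 -> {RV P >-> nat}).
Context (S : nat -> 'I_2 -> nat -> {RV P >-> R}).
Context (samplingMS : sampling_scheme h M S).

Lemma good_windows_block_trace (n k N : nat) (u : R) (W : {set 'I_N}) w :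
    (0 < n)%N -> 0 < h n -> 0 < u ->
    N%:R * ((u + 1 + u) * h n) <= 1 -> 1 <= horizon h n ->
    (forall m, m \in W ->
      good_window h M S n k (m%:R * ((u + 1 + u) * h n)) (u * h n) w) ->
  #|W|%:R * (k.*2.+1%:R * (u + 1 + u))^-1 ^+ 2
    <= block_trace M S (fun j => j%:R) 1 n 1 w.
Proof.
move=> n0 h0 u0 NB T1 good.
have B0 : 0 < (u + 1 + u) * h n by rewrite mulr_gt0 //; lra.
have v0 : 0 < u * h n by rewrite mulr_gt0.
have -> : (k.*2.+1%:R * (u + 1 + u))^-1 =
    h n / k.*2.+1%:R / ((u + 1 + u) * h n).
  by field; rewrite !gt_eqF //=; lra.
apply: (block_trace_ge samplingMS) => //; first by rewrite divr_gt0.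
move=> m mW; set b := m%:R * _.
have bE : b + u * h n + h n + u * h n = m.+1%:R * ((u + 1 + u) * h n).
  by rewrite /b -(addn1 m) natrD; ring.
have b0 : 0 <= b by rewrite mulr_ge0 // ltW.
have bT : b + u * h n + h n + u * h n <= horizon h n.
  rewrite bE; apply: le_trans T1; apply: le_trans NB.
  by rewrite ler_pM2r // ler_nat ltn_ord.
have [a cell] := @window_cell R (fun l => M n l w) (fun l i => S n l i w)
  k b (u * h n) (h n) (horizon h n) (samplingMS n0 ^~ w) b0 v0 h0 bT (good m mW).
by exists a => l; have [i iM ?] := cell l; exists i => //; rewrite -bE.
Qed.

(** With [B = (u + 1 + u) * h n] and [N] the integer part of [1 / B], the windows
fill at least half of the unit block, so [N * h n] is at least
[1 / (2 * (u + 1 + u))]; a quarter of the windows being good gives the constant. *)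
Lemma block_trace_prob (n k : nat) (K u : R) :
    (0 < n)%N -> 0 < h n -> 0 < u -> K <= k%:R ->
    (u + 1 + u) * h n <= 2^-1 -> 1 <= horizon h n ->
    (forall l t, 0 <= t <= horizon h n - u * h n ->
      (P [set w | increment M S n l t (t + u * h n) w = 0%R] <= 16^-1%:E)%E) ->
    (forall l t, 0 <= t <= horizon h n - h n ->
      (P [set w | (K < `|increment M S n l t (t + h n) w|)%R] <= 16^-1%:E)%E) ->
  (4^-1%:E <= P [set w |
    ((k.*2.+1%:R * (u + 1 + u))^-1 ^+ 2 / (8 * (u + 1 + u))
      <= h n * block_trace M S (fun j => j%:R) 1 n 1 w)%R])%E.
Proof.
move=> n0 h0 u0 Kk Bhalf T1 gaps crowd.
set w0 := u + 1 + u in Bhalf *; have w0_gt0 : 0 < w0 by rewrite /w0; lra.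
pose B := w0 * h n; have B0 : 0 < B by rewrite mulr_gt0.
pose N := Num.truncn B^-1.
have /andP[NB NB1] : N%:R <= B^-1 < N.+1%:R by apply: truncn_itv; rewrite invr_ge0 ltW.
have {}NB : N%:R * B <= 1 by rewrite -ler_pdivlMr // mul1r.
have {NB1} NBhalf : 2^-1 <= N%:R * B.
  have : 1 <= (N%:R + 1) * B.
    by rewrite -(@natrD _ N 1) addn1 -ler_pdivrMr // mul1r ltW.
  by rewrite mulrDl mul1r; move: Bhalf; rewrite -/B; lra.
have N0 : (0 < N)%N.
  by rewrite lt0n; apply: contraTneq NBhalf => ->; rewrite mul0r -ltNge; lra.
pose E (m : 'I_N) := good_window h M S n k (m%:R * B) (u * h n).
have mPE m : measurable (E m) /\ ((4^-1 + 4^-1)%:E <= P (E m))%E.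
  apply: (good_window_prob (K := K)) => //; first by rewrite mulr_ge0 // ltW.
  have -> : m%:R * B + u * h n + h n + u * h n = m.+1%:R * B.
    by rewrite /B /w0 -(addn1 m) natrD; ring.
  by apply: le_trans T1; apply: le_trans NB; rewrite ler_pM2r // ler_nat ltn_ord.
have count := reverse_markov_count N0 (_ : 0 <= 4^-1)
  (fun m => proj1 (mPE m)) (fun m => proj2 (mPE m)).
apply: le_trans (count _) _; first by lra.
apply: le_measure; rewrite ?inE.
- rewrite -[X in measurable X]setTI; apply: measurable_fun_le => //.
  by apply: measurable_sum => m; apply: measurable_indic; case: (mPE m).
- rewrite -[X in measurable X]setTI; apply: measurable_fun_le => //.
  apply: measurable_funM; first exact: measurable_cst.
  exact: (measurable_block_trace samplingMS).
move=> w /=; pose W : {set 'I_N} := finset (fun m => w \in E m).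
have -> : \sum_(m < N) \1_(E m) w = #|W|%:R :> R.
  rewrite -sum1_card natr_sum [RHS]big_mkcond /=; apply: eq_bigr => m _.
  by rewrite indicE finset.in_set; case: (_ \in _).
move=> NW; set c := _ ^+ 2.
have c0 : 0 <= c by rewrite sqr_ge0.
have trW : #|W|%:R * c <= block_trace M S (fun j => j%:R) 1 n 1 w.
  by apply: good_windows_block_trace => // m; rewrite inE => /set_mem.
apply: (@le_trans _ _ (h n * (#|W|%:R * c))); last by rewrite ler_pM2l.
apply: (@le_trans _ _ (h n * (N%:R * 4^-1 * c))); last first.
  by rewrite ler_pM2l // ler_wpM2r.
rewrite ler_pdivrMr ?mulr_gt0 //.
have -> : h n * (N%:R * 4^-1 * c) * (8 * w0) = c * (2 * (N%:R * B)).
  by rewrite /B; field.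
by rewrite -[leLHS]mulr1 ler_wpM2l //; lra.
Qed.

End trace_estimate.

Theorem proposition2p3 (d : measure_display) (T : measurableType d)
    (R : realType) (P : probability T R)
    (h : nat -> R)
    (M : nat -> 'I_2 -> {RV P >-> nat})
    (S : nat -> 'I_2 -> nat -> {RV P >-> R})
    (a0 : 'I_2 -> R) (a : nat -> R)
    (h_gt0 : forall n, (0 < n)%N -> 0 < h n)
    (h_cvg0 : h @ \oo --> (0 : R))
    (nh_cvgy : (fun n : nat => n%:R * h n) @ \oo --> +oo)
    (nh2_cvg0 : (fun n : nat => n%:R * h n ^+ 2) @ \oo --> (0 : R))
    (samplingMS : sampling_scheme h M S)
    (A4B2 : exists q : R, [/\ 0 < q, condA4 h M S a0 a & condB2 h M S q])
    (tightN : tight_increments h M S)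
    (mixingN : summable_mixing h M S) :
  0 < a 1%N.
Proof.
have [q [q0 [_ _ /(_ 1%N isT)[a1_ge0 cvg_trace]] condB]] := A4B2.
rewrite lt_neqAle a1_ge0 andbT; apply/eqP => a1_eq0.
have e16 : 0 < 16^-1 :> R by lra.
have [u u0 gaps] := condB2_small q0 e16 condB.
have [K crowd] := tightN _ e16.
pose k := (Num.truncn K).+1.
have Kk : K <= k%:R by rewrite ltW // truncnS_gt.
have w0_gt0 : 0 < u + 1 + u by lra.
pose c : R := (k.*2.+1%:R * (u + 1 + u))^-1 ^+ 2 / (8 * (u + 1 + u)).
have c0 : 0 < c.
  by apply: divr_gt0; [rewrite exprn_gt0 // invr_gt0|]; rewrite mulr_gt0.
(* Half of [c]: convergence in probability is about strict exceedance. *)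
have c2 : 0 < c / 2 by rewrite divr_gt0.
suff : (4^-1%:E <= 0 :> \bar R)%E by rewrite lee_fin; lra.
apply: (cvge_to_ge (cvg_trace _ (partitions_natr R) _ c2)).
have h_small : \forall n \near \oo, h n < ((u + 1 + u) * 2)^-1.
  by apply: (cvgr_lt 0) => //; rewrite invr_gt0 mulr_gt0.
have T_large : \forall n \near \oo, 1 <= horizon h n by exact: (cvgry_ge nh_cvgy 1).
near=> n.
have n0 : (0 < n)%N by near: n; exact: nbhs_infty_gt.
have h0 := h_gt0 _ n0.
have T1 : 1 <= horizon h n by near: n.
have Bhalf : (u + 1 + u) * h n <= 2^-1.
  have : h n < ((u + 1 + u) * 2)^-1 by near: n.
  by rewrite invfM -ltr_pdivrMl ?invr_gt0 // invrK => /ltW.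
apply: le_trans (block_trace_prob samplingMS n0 h0 u0 Kk Bhalf T1 _ _) _.
- by move=> l t; apply: gaps.
- by move=> l t tT; apply: (crowd (n, l, t)).
apply: le_measure; rewrite ?inE.
- rewrite -[X in measurable X]setTI; apply: measurable_fun_le => //.
  apply: measurable_funM; first exact: measurable_cst.
  exact: (measurable_block_trace samplingMS).
- apply: measurable_norm_gt; apply: measurable_bigmax => j.
  apply: measurableT_comp => //; apply: measurable_funB; last exact: measurable_cst.
  apply: measurable_funM; first exact: measurable_cst.
  exact: (measurable_block_trace samplingMS).
move=> w /=; rewrite -/c => cw.
have c_lt : c / 2 < c by lra.
apply: (lt_le_trans c_lt); apply: (le_trans cw).
apply: le_trans (ler_norm _).
apply: (@le_trans _ _ `|h n * block_trace M S (fun j => j%:R) 1 n 1 w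
    - a 1%N * (1 - 0)|).
  by rewrite -a1_eq0 mul0r subr0 ler_norm.
apply: (@bigmax_sup_seq _ _ _ _ _ 1%N) => //.
by rewrite mem_index_iota /= ltnS; exact: nblocks_natr_gt0.
Unshelve. all: by end_near.
Qed.
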